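(* Let $(W,\|\cdot\|)$ be a normed linear space, $Q\subseteq W$ with $Q\neq\emptyset$, and $z\in W$. Let $f:Q\to Q$ and $F:Q\to CL(Q)$ be maps satisfying the following: (i) there is $k\in U$ such that for every $v\in B_Q(z)$ and every $w\in Q$ with $fw\in Fv$, $D(fw,Fw)\le k(\|fv-fw\|)\,\|fv-fw\|$; (ii) $f(B_Q(z))=B_Q(z)$ and $B_Q(z)$ is complete; (iii) $\sup_{u\in Fp}\|u-z\|\le \|fp-z\|$ for each $p\in B_Q(z)$. Suppose that whenever $(fw_n)_n$ is a sequence in $B_Q(z)$ with $fw_n\in Fw_{n-1}$ for every $n$ and $fw_n\to fw$, one has $D(fw,Fw)\le\liminf_{n\to\infty}D(fw_n,Fw_n)$. Then there is a point $w^*\in Coin(f,F)\cap B_Q(z)$. Furthermore, $Fix(f,F)\cap B_Q(z)\neq\emptyset$ if $ffw^*=fw^*$ and $ffw^*\in Ffw^*$.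
   Context: $CL(Q)$ is the collection of all nonempty closed subsets of $Q$. For a point $u$ and a set $Z$, $D(u,Z)=\inf_{v\in Z}\|u-v\|$. $B_Q(z)=\{y\in Q:\|y-z\|=D(z,Q)\}$ is the set of best $Q$-approximants of $z$ over $Q$. $U$ is the set of functions $h:[0,\infty)\to[0,1)$ such that $\limsup_{r\to t^+}h(r)<1$ for every $t\in[0,\infty)$. $fw$ means $f(w)$, $ffw$ means $f(f(w))$, $Fw$ means $F(w)$, $Ffw$ means $F(f(w))$. $Coin(f,F)=\{w\in Q: fw\in Fw\}$ is the set of coincidence points and $Fix(f,F)=\{w\in Q: w=fw\in Fw\}$ is the set of common fixed points.
   Formalization: The set B_Q(z) is additionally assumed nonempty; otherwise the claim fails, e.g. W = R, Q = (0,1), z = 2, f the identity, Fx = {x}, where B_Q(z) is empty and all hypotheses hold vacuously. *)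

(* Defs.v *)
From HB Require Import structures.
From mathcomp Require Import all_boot all_order all_algebra.
From mathcomp Require Import all_classical all_reals all_analysis.

Set Implicit Arguments.
Unset Strict Implicit.
Unset Printing Implicit Defensive.

Import Order.TTheory GRing.Theory Num.Theory.
Import numFieldNormedType.Exports.

Local Open Scope classical_set_scope.
Local Open Scope ring_scope.

Definition dist_set (R : realType) (W : normedModType R) (u : W) (Z : set W) : R :=
  inf [set `|u - v| | v in Z].

Definition best_approx (R : realType) (W : normedModType R) (Q : set W) (z : W) :
    set W :=
  [set y | Q y /\ `|y - z| = dist_set z Q].

(* Closedness is relative to Q: for A included in Q, [closed] in [subspace Q]
   means that A is the trace on Q of a closed set of W. *)
Definition CL (R : realType) (W : normedModType R) (Q : set W) : set (set W) :=
  [set A | [/\ A !=set0, A `<=` Q & closed (A : set (subspace Q))]].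

(* Only the values of h on [0, +oo) matter.  The limsup is taken in the
   extended reals, along the punctured right neighbourhoods of t. *)
Definition classU (R : realType) : set (R -> R) :=
  [set h : R -> R | @set_fun R R `[0, +oo[ `[0, 1[ h /\
    forall t : R, 0 <= t -> (limf_esup (EFin \o h) t^'+ < 1%:E)%E].
Arguments classU : clear implicits.

Definition complete_subset (R : realType) (W : normedModType R) (A : set W) : Prop :=
  forall u : nat -> W, (forall n, A (u n)) -> cauchy (u @ \oo) ->
    exists2 l, A l & u @ \oo --> l.

Definition Coin (R : realType) (W : normedModType R) (Q : set W)
    (f : W -> W) (F : W -> set W) : set W :=
  [set w | Q w /\ F w (f w)].

Definition Fix (R : realType) (W : normedModType R) (Q : set W)
    (f : W -> W) (F : W -> set W) : set W :=
  [set w | [/\ Q w, w = f w & F w (f w)]].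

(* Main.v *)
(* With d = D(z, Q), every u in F p, for p in B_Q(z), satisfies
   d <= |u - z| <= |f p - z| = d, so F maps B_Q(z) into subsets of
   B_Q(z) = f(B_Q(z)).  If there is no coincidence point in B_Q(z), one can
   therefore iterate: given f w in F v, choose w' with f w' in F w and
   |f w - f w'| < (1 + k t) / 2 * t, where t = |f v - f w| > 0.  The distances t
   decrease strictly, and the limsup condition at the right of their limit makes
   them eventually geometric.  Hence (f w_n) converges to some f w in B_Q(z), and
   lower semicontinuity together with the closedness of F w gives f w in F w. *)
Require Import Defs.
From HB Require Import structures.
From mathcomp Require Import all_boot all_order all_algebra.
From mathcomp Require Import all_classical all_reals all_analysis.
From mathcomp Require Import lra.

Set Implicit Arguments.
Unset Strict Implicit.
Unset Printing Implicit Defensive.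

Import Order.TTheory GRing.Theory Num.Theory.
Import numFieldNormedType.Exports.

Local Open Scope classical_set_scope.
Local Open Scope ring_scope.

Section DistSet.
Variables (R : realType) (W : normedModType R).
Implicit Types (u v : W) (Z Q : set W).

Lemma dist_set_le u v Z : Z v -> dist_set u Z <= `|u - v|.
Proof.
move=> Zv; apply: ge_inf; last by exists v.
by exists 0 => _ [x _ <-].
Qed.

Lemma dist_set_ge0 u Z : 0 <= dist_set u Z.
Proof.
have [->|/set0P[v Zv]] := eqVneq Z set0; first by rewrite /dist_set image_set0 inf0.
by apply: lb_le_inf => [|_ [x _ <-]//]; exists `|u - v|, v.
Qed.

Lemma dist_set_lt u Z (e : R) : Z !=set0 -> dist_set u Z < e ->
  exists2 v, Z v & `|u - v| < e.
Proof.
move=> [v Zv] ule.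
have hi : has_inf [set `|u - v| | v in Z].
  by split; [exists `|u - v|, v|exists 0 => _ [x _ <-]].
have e0 : 0 < e - dist_set u Z by rewrite subr_gt0.
have [_ [x Zx <-]] := inf_adherent e0 hi.
by rewrite -/(dist_set u Z) subrKC => ?; exists x.
Qed.

(** Members of [CL Q] are closed only relative to [Q], hence the hypothesis [Q u]: the
    neighbourhoods of [u] in [subspace Q] are traces of balls, and distance zero puts a point of [A]
    in each. *)
Lemma CL_dist0 Q A u : CL Q A -> Q u -> dist_set u A = 0 -> A u.
Proof.
move=> [A0 AQ cA] Qu uA0; apply: cA => B.
have inQ : within Q (nbhs u) = nbhs (u : subspace Q) by exact: nbhs_subspace_in.
rewrite -inQ => /nbhs_ballP[e /= e0 ball_B].
have [|v Av uve] := @dist_set_lt u A e A0; first by rewrite uA0.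
exists v; split => //; apply: ball_B; last exact: AQ.
by rewrite -ball_normE.
Qed.

Lemma best_approx_sub Q (z p u : W) : best_approx Q z p -> Q u ->
  `|u - z| <= `|p - z| -> best_approx Q z u.
Proof.
move=> [_ pz] Qu; rewrite pz => uz; split => //; apply/le_anti.
by rewrite uz /= distrC dist_set_le.
Qed.

End DistSet.

Section Geometric.
Variable R : realType.
Implicit Types (t : nat -> R) (k : R -> R).

(** The limsup is an infimum, over punctured right neighbourhoods, of suprema of [k]; being below 1,
    it is undercut by one such supremum, which serves as [a]. *)
Lemma classU_right_lt1 k (r : R) : classU R k -> 0 <= r ->
  exists2 a : R, a < 1 & \forall s \near r^'+, k s <= a.
Proof.
move=> [_ /[apply]] /ereal_inf_lt[_ [V rV <-] V1].
have kV s : V s -> ((k s)%:E <= ereal_sup [set (EFin \o k) x | x in V])%E.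
  by move=> Vs; apply: ereal_sup_ubound; exists s.
case: (ereal_sup _) V1 kV => [a a1 kV|//|_ kV].
- by exists a => //; apply: filterS rV => s /kV; rewrite lee_fin.
(* A supremum equal to -oo means that [V] is empty, so any [a] below 1 would do. *)
- by exists 0 => //; apply: filterS rV => s /kV.
Qed.

Lemma classU_eventually_geometric k t : classU R k -> (forall n, 0 < t n) ->
  (forall n, t n.+1 < (1 + k (t n)) / 2 * t n) ->
  exists2 q : R, q < 1 & \forall n \near \oo, t n.+1 <= q * t n.
Proof.
move=> kU t0 tS.
have k1 r : 0 <= r -> 0 <= k r < 1.
  by move=> r0; have := kU.1 r; rewrite /= !in_itv /= andbT => /(_ r0).
have tlt n : t n.+1 < t n.
  apply: lt_trans (tS n) _; rewrite gtr_pMl//.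
  by have /andP[] := k1 _ (ltW (t0 n)); lra.
have tn : {homo t : n m / (n <= m)%N >-> m <= n}.
  by apply/nonincreasing_seqP => n; exact: ltW.
have tc : cvgn t.
  by apply: nonincreasing_is_cvgn => //; exists 0 => _ [n _ <-]; exact: ltW.
have l0 : 0 <= limn t by apply: limr_ge => //; apply: nearW => n; exact: ltW.
have [a a1 ka] := classU_right_lt1 kU l0.
exists ((1 + a) / 2); first lra.
near=> n.
(* Strictness matters: the neighbourhood of the limit on which [k] is at most [a] is punctured. *)
have lt_lim : limn t < t n.
  exact: le_lt_trans (nonincreasing_cvgn_ge tn tc n.+1) (tlt n).
have kn : k (t n) <= a by move: lt_lim; near: n; exact: tc ka.
apply: (le_trans (ltW (tS n))); rewrite ler_wpM2r ?(ltW (t0 n))//; lra.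
Unshelve. all: by end_near. Qed.

(** A tail of [t] is nonincreasing, and its limit l satisfies 0 <= l <= q l, which forces l = 0
    since q < 1. No sign condition on [q] is involved. *)
Lemma eventually_geometric_cvg0 t (q : R) : q < 1 -> (forall n, 0 <= t n) ->
  (\forall n \near \oo, t n.+1 <= q * t n) -> t @ \oo --> 0.
Proof.
move=> q1 t0 tq.
case: tq => N _ tN.
pose s n := t (n + N)%N.
have sq n : s n.+1 <= q * s n by rewrite /s addSn; apply: tN => /=; exact: leq_addl.
have s0 n : 0 <= s n by exact: t0.
have sn : {homo s : n m / (n <= m)%N >-> m <= n}.
  apply/nonincreasing_seqP => n; apply: le_trans (sq n) _.
  by rewrite ler_piMl// ltW.
have sc : cvgn s by apply: nonincreasing_is_cvgn => //; exists 0 => _ [n _ <-].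
have l0 : 0 <= limn s by apply: limr_ge => //; exact: nearW.
have lq : limn s <= q * limn s.
  have sSc : s n.+1 @[n --> \oo] --> limn s by rewrite (cvg_shiftS s).
  by apply: (ler_cvg_to sSc (cvgMl_tmp (a := q) sc)); exact: nearW.
have l_eq0 : limn s = 0 by apply/le_anti; rewrite l0 andbT; nra.
by rewrite l_eq0 (cvg_shiftn N) in sc.
Qed.

Lemma eventually_geometric_cauchy (W : normedModType R) (u : nat -> W) (q : R) :
  q < 1 ->
  (\forall n \near \oo, `|u n.+1 - u n.+2| <= q * `|u n - u n.+1|) ->
  cauchy (u @ \oo).
Proof.
move=> q1 uq; set t := fun n => `|u n - u n.+1|.
have tc : t @ \oo --> 0.
  by apply: (eventually_geometric_cvg0 q1) => // n; exact: normr_ge0.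
have [N _ tN] := uq.
(* |u_n - u_{n+1}| <= (t_n - t_{n+1}) / (1 - q), which telescopes. *)
have tel n i : (N <= n)%N -> (1 - q) * `|u n - u (n + i)%N| <= t n - t (n + i)%N.
  move=> Nn; elim: i => [|i IH]; first by rewrite addn0 !subrr normr0 mulr0.
  have /= := tN (n + i)%N (leq_trans Nn (leq_addr _ _)).
  rewrite -/(t (n + i)%N) addnS -/(t (n + i).+1) => tS.
  have := ler_distD (u (n + i)%N) (u n) (u (n + i).+1).
  rewrite -/(t (n + i)%N) => /(ler_wpM2l (ltW _ : 0 <= 1 - q)).
  rewrite subr_gt0 => /(_ q1); lra.
apply: cauchy_exP => e e0.
have [M _ tM] : \forall n \near \oo, t n < (1 - q) * e.
  by apply: (cvgr_lt 0 tc); rewrite mulr_gt0// subr_gt0.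
exists (u (maxn N M)), (maxn N M) => //= m mm.
rewrite -ball_normE /= -(subnKC mm).
rewrite -(@ltr_pM2l _ (1 - q)) ?subr_gt0//.
apply: le_lt_trans (tel _ _ (leq_maxl _ _)) _.
apply: le_lt_trans (tM _ (leq_maxr N M)).
by rewrite gerBl normr_ge0.
Qed.

End Geometric.

Theorem theorem3p2 (R : realType) (W : normedModType R) (Q : set W) (z : W)
    (f : W -> W) (F : W -> set W)
    (Q_neq0 : Q !=set0)
    (fQ : set_fun Q Q f)
    (FQ : set_fun Q (CL Q) F)
    (B_neq0 : best_approx Q z !=set0)
    (contr : exists2 k : R -> R, classU R k &
      forall v w : W, best_approx Q z v -> Q w -> F v (f w) ->
        dist_set (f w) (F w) <= k `|f v - f w| * `|f v - f w|)
    (fB : f @` best_approx Q z = best_approx Q z)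
    (B_complete : complete_subset (best_approx Q z))
    (sup_le : forall p : W, best_approx Q z p ->
      (ereal_sup [set `|u - z|%:E | u in F p] <= `|f p - z|%:E)%E)
    (lsc : forall (w_ : nat -> W) (w : W),
      (forall n, Q (w_ n)) -> Q w ->
      (forall n, best_approx Q z (f (w_ n))) ->
      (forall n, F (w_ n) (f (w_ n.+1))) ->
      (f \o w_) @ \oo --> f w ->
      ((dist_set (f w) (F w))%:E <=
        limn_einf (fun n => (dist_set (f (w_ n)) (F (w_ n)))%:E))%E) :
  (exists w : W, (Coin Q f F `&` best_approx Q z) w) /\
  (forall w : W, (Coin Q f F `&` best_approx Q z) w ->
     f (f w) = f w -> F (f w) (f (f w)) ->
     Fix Q f F `&` best_approx Q z !=set0).
Proof.
set B := best_approx Q z in fB B_complete sup_le lsc contr B_neq0 *.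
have fBB w : B w -> B (f w) by move=> Bw; rewrite -fB; exists w.
split; last first.
  by move=> w [_ /fBB Bfw] ffw Fffw; exists (f w); split=> //; split=> //; exact: Bfw.1.
(* Points of [F w] lie in [B], which is the image of [B] under [f]; this provides the next
   iterate. *)
have FB w u : B w -> F w u -> exists2 w', B w' & f w' = u.
  move=> Bw Fu; suff: B u by rewrite -{1}fB.
  have [_ FwQ _] := FQ _ Bw.1.
  apply: (best_approx_sub (fBB _ Bw) (FwQ _ Fu)).
  rewrite -lee_fin; apply: le_trans (sup_le _ Bw).
  by apply: ereal_sup_ubound; exists u.
have F0 w : B w -> F w !=set0 by move=> [/FQ[]].
have [//|noCoin] := pselect (exists w, (Coin Q f F `&` B) w).
case: contr => k kU contr.
(* A state of the iteration is a pair of consecutive iterates, with the facts that [contr] needs to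
   produce the next one. *)
pose T := {p : W * W | [/\ B p.1, B p.2 & F p.1 (f p.2)]}.
pose t (p : W * W) := `|f p.1 - f p.2|.
have t_gt0 (p : T) : 0 < t (sval p).
  case: p => -[v w] [/= Bv Bw Fvw]; rewrite /t /= normr_gt0 subr_eq0.
  (* If [f v = f w], then [F v (f w)] makes [v] a coincidence point. *)
  apply/eqP => fvw; apply: noCoin; exists v; split=> //; split; [exact: Bv.1|by rewrite /= fvw].
have step (p : T) : {p' : T | (sval p').1 = (sval p).2 /\
    t (sval p') < (1 + k (t (sval p))) / 2 * t (sval p)}.
  apply: cid; have := t_gt0 p; case: p => -[v w] [/= Bv Bw Fvw].
  rewrite {1}/t /= => t0.
  have : k `|f v - f w| < 1.
    have := kU.1 `|f v - f w|; rewrite /= !in_itv /= normr_ge0.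
    by move=> /(_ erefl)/andP[].
  have := contr _ _ Bv Bw.1 Fvw.
  rewrite /t /=; set r := `|f v - f w| => D k1.
  (* The infimum need not be attained; the midpoint of [k r] and 1 leaves room above it while
     keeping the factor below 1. *)
  have [|u Fwu ul] := @dist_set_lt _ _ (f w) (F w) ((1 + k r) / 2 * r) (F0 _ Bw).
    by apply: le_lt_trans D _; rewrite ltr_pM2r//; lra.
  have [w' Bw' w'u] := FB _ _ Bw Fwu.
  have Fww' : F w (f w') by rewrite w'u.
  exists (exist _ (w, w') (And3 Bw Bw' Fww')) => /=; split => //.
  by rewrite w'u.
have [w0 Bw0] := B_neq0; have [u0 Fu0] := F0 _ Bw0.
have [w1 Bw1 w1u] := FB _ _ Bw0 Fu0.
have Fw01 : F w0 (f w1) by rewrite w1u.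
pose p_ n : T :=
  iter n (fun p => sval (step p)) (exist _ (w0, w1) (And3 Bw0 Bw1 Fw01)).
pose w_ n := (sval (p_ n)).1.
have w_S n : w_ n.+1 = (sval (p_ n)).2 by case: (svalP (step (p_ n))).
have tE n : t (sval (p_ n)) = `|f (w_ n) - f (w_ n.+1)| by rewrite w_S.
have Bw_ n : B (w_ n) by case: (svalP (p_ n)).
have Fw_ n : F (w_ n) (f (w_ n.+1)) by rewrite w_S; case: (svalP (p_ n)).
have [q q1 tq] : exists2 q : R, q < 1 & \forall n \near \oo,
    t (sval (p_ n.+1)) <= q * t (sval (p_ n)).
  apply: (classU_eventually_geometric kU) => n; first exact: t_gt0.
  by case: (svalP (step (p_ n))).
have uq : \forall n \near \oo, `|(f \o w_) n.+1 - (f \o w_) n.+2| <=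
    q * `|(f \o w_) n - (f \o w_) n.+1|.
  by apply: filterS tq => n; rewrite !tE.
have [l Bl fwl] := B_complete _ (fun n => fBB _ (Bw_ n))
  (eventually_geometric_cauchy q1 uq).
have [w Bw fw] : (f @` B) l by rewrite fB.
rewrite -fw in fwl.
have := lsc w_ w (fun n => (Bw_ n).1) Bw.1 (fun n => fBB _ (Bw_ n)) Fw_ fwl.
(* Since [f (w_ n.+1)] lies in [F (w_ n)], the distance is squeezed between 0 and the step length,
   so the liminf in [lsc] is 0. *)
have dc : (fun n => dist_set (f (w_ n)) (F (w_ n))) @ \oo --> 0.
  apply: (squeeze_cvgr _ (cvg_cst 0)
    (eventually_geometric_cvg0 q1 (fun n => ltW (t_gt0 _)) tq)).
  by apply: nearW => n; rewrite dist_set_ge0 tE dist_set_le.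
have /cvg_limn_einf_sup[-> _] :
    (fun n => (dist_set (f (w_ n)) (F (w_ n)))%:E) @ \oo --> 0%:E.
  by apply: cvg_EFin => //; exact: nearW.
rewrite lee_fin => d0; exists w; split=> //; split; first exact: Bw.1.
apply: (CL_dist0 (FQ _ Bw.1) (fBB _ Bw).1); apply/le_anti.
by rewrite d0 dist_set_ge0.
Qed.
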